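(* Let $p$ be a prime greater than $2$, $m$ a positive integer, and $f \colon GF(p)^{2m} \to GF(p)$ an even function with $f(0)=0$. Suppose that the component Cayley graphs $\Gamma_i$ ($1\le i\le p$) of $f$ are all strongly regular and are either all of feasible Latin square type or all of feasible negative Latin square type. Then the component Cayley graphs $\Gamma_i^*$ of the dual function $f^*$ are also all strongly regular, and for each $i$ the parameters of $\Gamma_i^*$ equal those of $\Gamma_i$.
   Context: Let $\zeta = e^{2\pi i/p}$, identify $GF(p)$ with $\{0,\dots,p-1\}$, $\langle\ ,\ \rangle$ the standard inner product; $W_f(x) = \sum_y \zeta^{f(y)-\langle x,y\rangle}$. For an even $g\colon GF(p)^{2m}\to GF(p)$ with $g(0)=0$: its level sets are $g^{-1}(i)$ for $1 \le i \le p-1$ and $g^{-1}(0)\setminus\{0\}$ (index $p$), and its $i$th component Cayley graph is the graph on $GF(p)^{2m}$ with distinct $x,y$ adjacent iff $x-y$ lies in the $i$th level set. A strongly regular graph with parameters $(\nu,k,\lambda,\mu)$ is $k$-regular on $\nu$ vertices, adjacent vertices having $\lambda$ and distinct nonadjacent vertices $\mu$ common neighbors. The graphs $\Gamma_i$ are all of feasible Latin square type (resp. feasible negative Latin square type) if each $\Gamma_i$ is strongly regular with parameters $(N^2,(N-1)r_i, N+r_i^2-3r_i, r_i^2-r_i)$, where $N=p^m$ (resp. $N=-p^m$), $r_i = N/p$ for $1\le i\le p-1$, $r_p = N/p+1$. Under these hypotheses $f$ is bent with $W_f(x) = \zeta^{f^*(x)}p^m$ (Latin case) or $W_f(x) =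 -\zeta^{f^*(x)}p^m$ (negative Latin case) for a unique $f^*\colon GF(p)^{2m}\to GF(p)$, the dual of $f$, which is even with $f^*(0)=0$; $\Gamma_i^*$ is the $i$th component Cayley graph of $f^*$. *)

(* Defs.v *)
From HB Require Import structures.
From mathcomp Require Import all_boot all_order all_algebra.
From mathcomp Require Import complex.
From mathcomp Require Import reals trigo.

Set Implicit Arguments.
Unset Strict Implicit.
Unset Printing Implicit Defensive.

Import Order.TTheory GRing.Theory Num.Theory.
Local Open Scope ring_scope.

(* e^(2 pi i / p) *)
Definition zeta (R : realType) (p : nat) : R[i] :=
  (cos (2 * pi / p%:R) +i* sin (2 * pi / p%:R))%C.

Definition dot (F : pzRingType) (n : nat) (x y : 'rV[F]_n) : F :=
  \sum_(j < n) x 0 j * y 0 j.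

(* The exponent is an element of 'F_p, coerced to its representative in
   {0, ..., p - 1}. *)
Definition walsh (R : realType) (p n : nat) (f : 'rV['F_p]_n -> 'F_p)
    (x : 'rV['F_p]_n) : R[i] :=
  \sum_(y : 'rV['F_p]_n) zeta R p ^+ (f y - dot x y)%R.

(* For N = p ^ m (resp. N = - p ^ m), the two cases W_f = zeta ^ f* p ^ m
   (resp. W_f = - zeta ^ f* p ^ m) of the definition of the dual f* of f. *)
Definition is_dual (R : realType) (p n : nat) (N : int)
    (f fstar : 'rV['F_p]_n -> 'F_p) : Prop :=
  forall x, walsh R f x = zeta R p ^+ (fstar x) * N%:~R.

Definition even_fun (U : zmodType) (T : Type) (f : U -> T) : Prop :=
  forall x, f (- x) = f x.

Definition level_set (p n : nat) (f : 'rV['F_p]_n -> 'F_p) (i : nat) :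
    {set 'rV['F_p]_n} :=
  if i == p then [set x | (f x == 0) && (x != 0)]
  else [set x | nat_of_ord (f x) == i].

Definition component_graph (p n : nat) (f : 'rV['F_p]_n -> 'F_p) (i : nat) :
    rel 'rV['F_p]_n :=
  fun x y => (x != y) && (x - y \in level_set f i).

(* The parameters are integers: the feasible value of lambda is - p for the
   edgeless graph occurring as the p-th component when N = - p, where the
   condition on adjacent vertices is vacuous. *)
Definition strongly_regular (T : finType) (e : rel T) (v k l mu : int) : Prop :=
  [/\ symmetric e /\ irreflexive e,
      #|T|%:Z = v,
      forall x, #|[set z | e x z]|%:Z = k,
      forall x y, e x y -> #|[set z | e x z && e y z]|%:Z = l &
      forall x y, x != y -> ~~ e x y -> #|[set z | e x z && e y z]|%:Z = mu].

Definition feasible_r (p : nat) (N : int) (i : nat) : int :=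
  if i == p then (N %/ p%:Z)%Z + 1 else (N %/ p%:Z)%Z.

(* Feasible Latin square type for N = p ^ m, feasible negative Latin square
   type for N = - p ^ m. *)
Definition all_feasible_type (p n : nat) (N : int)
    (f : 'rV['F_p]_n -> 'F_p) : Prop :=
  forall i : nat, (1 <= i <= p)%N ->
    let r := feasible_r p N i in
    strongly_regular (component_graph f i)
      (N ^+ 2) ((N - 1) * r) (N + r ^+ 2 - 3 * r) (r ^+ 2 - r).

(* Main.v *)
Require Import Defs.
From HB Require Import structures.
From mathcomp Require Import all_boot all_order all_algebra.
From mathcomp Require Import complex ring.
From mathcomp Require Import reals trigo.

Set Implicit Arguments.
Unset Strict Implicit.
Unset Printing Implicit Defensive.

Import Order.TTheory GRing.Theory Num.Theory.
Local Open Scope ring_scope.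

(* Let r be the parameter of the i-th component graph Gamma_i of f. Its
   eigenvalues are the Fourier coefficients of the i-th level set; away from
   x = 0 they are N - r or - r. The level sets partition the nonzero vectors, so
   at x <> 0 the p coefficients add up to -1, which forces exactly one of them,
   of index sigma(x), to be N - r. Substituting in the Walsh transform gives
   W_f(x) = N zeta ^ sigma(x), so sigma is the dual f*. Hence the indicator of
   the i-th level set of f* is an affine function of the Fourier transform of
   the i-th level set of f, except at 0. Transforming once more, Fourier
   inversion shows that the i-th component graph of f* has the two eigenvalues
   of Gamma_i, hence the same parameters. *)

(** * The additive character of ['F_p] attached to [zeta] *)

Section AdditiveCharacter.

Variables (R : realType) (p : nat).

Definition chi (a : 'F_p) : R[i] := zeta R p ^+ a.

Lemma cisX (t : R) k :
  (cos t +i* sin t)%C ^+ k = (cos (t *+ k) +i* sin (t *+ k))%C.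
Proof.
elim: k => [|k IHk]; first by rewrite expr0 mulr0n cos0 sin0.
rewrite exprS IHk mulrS cosD sinD; congr (_ +i* _)%C; exact: addrC.
Qed.

Hypotheses (p_prime : prime p) (p_gt2 : (2 < p)%N).

(** The order divides the prime [p], and it is not 1: for [p > 2] the angle 2 pi / p lies strictly
    between 0 and pi, so its sine is positive. *)
Lemma zeta_prim_root : p.-primitive_root (zeta R p).
Proof.
have p0 : p%:R != 0 :> R by rewrite pnatr_eq0 -lt0n prime_gt0.
have zp : zeta R p ^+ p = 1.
  rewrite cisX -[_ *+ p]mulr_natr divfK // mulr_natl.
  by rewrite -[pi *+ 2]add0r cosD2pi sinD2pi cos0 sin0.
have [q q_prim] := prim_order_exists (prime_gt0 p_prime) zp.
move=> /(primeP p_prime).2 /orP[] /eqP qE; rewrite qE // in q_prim *.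
have := prim_expr_order q_prim; rewrite expr1 => /(congr1 (@complex.Im R)) /= s0.
have : 0 < sin (2 * pi / p%:R) :> R.
  apply: sin_gt0_pi; apply/andP; split.
    by rewrite divr_gt0 ?mulr_gt0 ?pi_gt0 ?ltr0n ?prime_gt0.
  by rewrite ltr_pdivrMr ?ltr0n ?prime_gt0 // mulrC ltr_pM2l ?pi_gt0 ?ltr_nat.
by rewrite s0 ltxx.
Qed.

Lemma chi0 : chi 0 = 1.
Proof. by []. Qed.

Lemma chiD a b : chi (a + b) = chi a * chi b.
Proof.
rewrite /chi -exprD /= expr_mod //.
by rewrite [X in _ ^+ X](Fp_cast p_prime) (prim_expr_order zeta_prim_root).
Qed.

Lemma chi_inj : injective chi.
Proof.
move=> a b /eqP; rewrite /chi (eq_prim_root_expr zeta_prim_root) => /eqP ab.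
have lt_p (c : 'F_p) : (c < p)%N by rewrite -[X in (_ < X)%N](Fp_cast p_prime).
by apply: val_inj; move: ab; rewrite !modn_small.
Qed.

Lemma chi_eq1 a : (chi a == 1) = (a == 0).
Proof. by rewrite -chi0 (inj_eq chi_inj). Qed.

(** Translating the summation index by 1 multiplies the sum by [chi 1], which differs from 1. *)
Lemma sum_chi : \sum_a chi a = 0.
Proof.
have chi1 : chi 1 - 1 != 0 by rewrite subr_eq0 chi_eq1 oner_eq0.
apply: (mulfI chi1); rewrite mulr0 mulrBl mul1r mulr_sumr; apply/eqP.
rewrite subr_eq0 [X in _ == X](reindex_inj (addrI 1)) /=.
by apply/eqP/eq_bigr => a _; rewrite chiD.
Qed.

End AdditiveCharacter.

(** * Fourier transform and convolution on the vector space [V] *)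

Section Fourier.

Variables (R : realType) (p n : nat).
Local Notation C := (R[i]).
Local Notation V := 'rV['F_p]_n.
Implicit Types (g h : V -> C) (x y z : V) (D : {set V}).

Definition fourier g x : C := \sum_y g y * chi R (- dot x y).

Definition conv g h z : C := \sum_y g y * h (z - y).

Definition indic D x : C := (x \in D)%:R.

Lemma dotC x y : dot x y = dot y x.
Proof. by apply: eq_bigr => j _; rewrite mulrC. Qed.

Lemma dotDr x y z : dot x (y + z) = dot x y + dot x z.
Proof. by rewrite -big_split; apply: eq_bigr => j _; rewrite mxE mulrDr. Qed.

Lemma dotDl x y z : dot (x + y) z = dot x z + dot y z.
Proof. by rewrite dotC dotDr !(dotC z). Qed.

Lemma dotNr x y : dot x (- y) = - dot x y.
Proof. by rewrite -sumrN; apply: eq_bigr => j _; rewrite mxE mulrN. Qed.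

Lemma dotNl x y : dot (- x) y = - dot x y.
Proof. by rewrite dotC dotNr dotC. Qed.

Lemma dot0l x : dot 0 x = 0.
Proof. by apply: big1 => j _; rewrite mxE mul0r. Qed.

Lemma dot_delta x j : dot x (delta_mx 0 j) = x 0 j.
Proof.
rewrite /dot (bigD1 j) //= mxE !eqxx mulr1 big1 ?addr0 // => k /negPf kj.
by rewrite mxE kj mulr0.
Qed.

Hypotheses (p_prime : prime p) (p_gt2 : (2 < p)%N).

Let chiD := chiD R p_prime p_gt2.

Lemma card_rV_Fp : #|{: V}| = (p ^ n)%N.
Proof. by rewrite card_mx card_Fp // mul1n. Qed.

Lemma sum_chi_dot x : \sum_y chi R (- dot x y) = (p ^ n)%:R * (x == 0)%:R.
Proof.
have [->|/rV0Pn[j xj]] := eqVneq x 0.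
  under eq_bigr do rewrite dot0l oppr0 chi0.
  by rewrite sumr_const cardT -cardE card_rV_Fp mulr1.
have chi1 : chi R (- x 0 j) - 1 != 0.
  by rewrite subr_eq0 chi_eq1 // oppr_eq0.
rewrite mulr0; apply: (mulfI chi1); rewrite mulr0 mulrBl mul1r mulr_sumr.
apply/eqP; rewrite subr_eq0 [X in _ == X](reindex_inj (addrI (delta_mx 0 j))) /=.
by apply/eqP/eq_bigr => y _; rewrite dotDr dot_delta opprD chiD.
Qed.

(** After exchanging the sums, orthogonality of characters keeps only the term [y = - z]; the
    reflection appears because both transforms carry the same sign. *)
Lemma fourier_inv g z : fourier (fourier g) z = (p ^ n)%:R * g (- z).
Proof.
rewrite /fourier; under eq_bigr do rewrite mulr_suml.
rewrite exchange_big /= (bigD1 (- z)) //= [X in _ + X]big1 ?addr0.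
  under eq_bigr => x _ do
    rewrite -mulrA -chiD (dotC x) -opprD -dotDl addNr.
  by rewrite -mulr_sumr sum_chi_dot eqxx mulr1 mulrC.
move=> y yz; under eq_bigr => x _ do
  rewrite -mulrA -chiD (dotC x) -opprD -dotDl.
by rewrite -mulr_sumr sum_chi_dot addr_eq0 (negPf yz) !mulr0.
Qed.

Lemma fourier_inj g h : fourier g =1 fourier h -> g =1 h.
Proof.
move=> gh z; have pn0 : (p ^ n)%:R != 0 :> C.
  by rewrite pnatr_eq0 -lt0n expn_gt0 prime_gt0.
apply: (mulfI pn0); rewrite -[z]opprK -!fourier_inv.
by apply: eq_bigr => x _; rewrite gh.
Qed.

Lemma fourier_conv g h x : fourier (conv g h) x = fourier g x * fourier h x.
Proof.
rewrite /fourier /conv; under eq_bigr do rewrite mulr_suml.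
rewrite exchange_big /= mulr_suml; apply: eq_bigr => y _.
rewrite (reindex_inj (addrI y)) /= mulr_sumr; apply: eq_bigr => z _.
by rewrite addrAC subrr add0r dotDr opprD chiD mulrACA.
Qed.

Lemma fourierZ c g x : fourier (fun y => c * g y) x = c * fourier g x.
Proof. by rewrite mulr_sumr; apply: eq_bigr => y _; rewrite mulrA. Qed.

Lemma fourier1 x : fourier (fun=> 1) x = (p ^ n)%:R * (x == 0)%:R.
Proof. by rewrite -sum_chi_dot; apply: eq_bigr => y _; rewrite mul1r. Qed.

Lemma fourier_delta0 x : fourier (fun y => (y == 0)%:R) x = 1.
Proof.
rewrite /fourier (bigD1 0) //= eqxx dotC dot0l oppr0 chi0 mulr1.
by rewrite big1 ?addr0 // => y /negPf ->; rewrite mul0r.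
Qed.

Lemma fourier_indic0 D : fourier (indic D) 0 = #|D|%:R.
Proof.
rewrite /fourier; under eq_bigr do rewrite dot0l oppr0 chi0 mulr1.
by rewrite -natr_sum -sum1_card [in RHS]big_mkcond.
Qed.

(** * Strong regularity of Cayley graphs through convolution and spectrum *)

Definition cayley D : rel V := fun x y => (x != y) && (x - y \in D).

Section CayleyGraph.

Variable D : {set V}.
Hypotheses (D_opp : forall x, (- x \in D) = (x \in D)) (D_0 : 0 \notin D).

Lemma cayleyE x y : cayley D x y = (x - y \in D).
Proof.
rewrite /cayley; case: eqVneq => //= ->.
by rewrite subrr (negPf D_0).
Qed.

Lemma cayley_sym : symmetric (cayley D).
Proof. by move=> x y; rewrite !cayleyE -D_opp opprB. Qed.

Lemma cayley_irr : irreflexive (cayley D).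
Proof. by move=> x; rewrite /cayley eqxx. Qed.

Lemma card_common_nbr x y :
  #|[set z | cayley D x z && cayley D y z]|%:R = conv (indic D) (indic D) (x - y).
Proof.
rewrite /conv (reindex_inj (subrI x)) /= -sum1_card natr_sum big_mkcond.
apply: eq_bigr => z _; rewrite inE !cayleyE /indic.
rewrite (_ : x - y - (x - z) = - (y - z)); last first.
  by rewrite !opprB addrC addrA subrK.
by rewrite D_opp; do 2!case: (_ \in D); rewrite ?mulr1 ?mulr0.
Qed.

Lemma card_nbr x : #|[set z | cayley D x z]| = #|D|.
Proof.
rewrite -(card_imset _ (subrI x)) /=; congr #|pred_of_set _|; apply/setP => z.
rewrite -[z](subKr x) (mem_imset _ _ (subrI x)) inE cayleyE.
by rewrite (subKr x).
Qed.

Lemma conv_indic0 : conv (indic D) (indic D) 0 = #|D|%:R.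
Proof.
rewrite -(subrr 0) -card_common_nbr -(card_nbr 0).
by congr (#|pred_of_set _|%:R); apply/setP => z; rewrite !inE andbb.
Qed.

(** This is the adjacency matrix identity A^2 = k I + l A + mu (J - I - A), read as an identity of
    functions on the group: the convolution counts common neighbours. *)
Lemma strongly_regular_conv v k l mu :
  strongly_regular (cayley D) v k l mu <->
  v = (p ^ n)%:Z /\
  forall z, conv (indic D) (indic D) z = k%:~R * (z == 0)%:R
    + l%:~R * indic D z + mu%:~R * (1 - (z == 0)%:R - indic D z).
Proof.
split.
  case=> _ vE kE lE muE; rewrite -vE card_rV_Fp; split=> // z.
  have [->|z0] := eqVneq z 0.
    rewrite conv_indic0 /indic (negPf D_0) -(kE 0) card_nbr -pmulrn /=; ring.
  rewrite -[z]subr0 -card_common_nbr !subr0 /indic pmulrn.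
  have zE : cayley D z 0 = (z \in D) by rewrite cayleyE subr0.
  case: (boolP (z \in D)) => zD.
    rewrite lE ?zE //=; ring.
  rewrite muE ?zE //=; ring.
case=> -> convE; split.
- split; [exact: cayley_sym | exact: cayley_irr].
- by rewrite card_rV_Fp.
- move=> x; rewrite card_nbr; apply/eqP; rewrite -(eqr_int C) -pmulrn.
  rewrite -conv_indic0 convE eqxx /indic (negPf D_0); apply/eqP => /=; ring.
- move=> x y exy; apply/eqP; rewrite -(eqr_int C) -pmulrn card_common_nbr convE.
  have xy : x != y by case/andP: exy.
  rewrite /indic -cayleyE exy subr_eq0 (negPf xy); apply/eqP => /=; ring.
move=> x y xy nexy; apply/eqP.
rewrite -(eqr_int C) -pmulrn card_common_nbr convE.
rewrite /indic -cayleyE (negPf nexy) subr_eq0 (negPf xy); apply/eqP => /=; ring.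
Qed.

(* The spectral form of strong regularity: the eigenvalues of a Cayley graph
   of an abelian group are the Fourier coefficients of its connection set. *)
Lemma strongly_regular_fourier v k l mu :
  strongly_regular (cayley D) v k l mu <->
  v = (p ^ n)%:Z /\
  forall x, fourier (indic D) x ^+ 2 = k%:~R + l%:~R * fourier (indic D) x
    + mu%:~R * ((p ^ n)%:R * (x == 0)%:R - 1 - fourier (indic D) x).
Proof.
(* The right-hand side of the convolution identity. Its transform is computed by linearity; the
   convolution becomes a square, and injectivity of the transform gives the converse. *)
pose rhs z : C := k%:~R * (z == 0)%:R
    + l%:~R * indic D z + mu%:~R * (1 - (z == 0)%:R - indic D z).
have rhsE x : fourier rhs x = k%:~R + l%:~R * fourier (indic D) x
    + mu%:~R * ((p ^ n)%:R * (x == 0)%:R - 1 - fourier (indic D) x).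
  transitivity (k%:~R * fourier (fun y => (y == 0)%:R) x
      + l%:~R * fourier (indic D) x + mu%:~R * (fourier (fun=> 1) x
        - fourier (fun y => (y == 0)%:R) x - fourier (indic D) x)); last first.
    by rewrite fourier1 fourier_delta0 mulr1.
  rewrite /fourier !mulr_sumr -!sumrB mulr_sumr -!big_split /=.
  by apply: eq_bigr => y _; rewrite /rhs; ring.
rewrite strongly_regular_conv; split=> -[-> H]; split=> // x.
  rewrite expr2 -fourier_conv -rhsE.
  by apply: eq_bigr => y _; rewrite H.
by apply: (@fourier_inj (conv _ _) rhs) => {}x; rewrite fourier_conv rhsE -H.
Qed.

End CayleyGraph.

End Fourier.

(** An edgeless or complete graph does not determine [l] or [mu], so one shared quadruple does not
    at once give the same set of quadruples. Equal degrees ensure that a condition vacuous for [e1]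
    is vacuous for [e2]. *)
Lemma strongly_regular_transfer (T : finType) (e1 e2 : rel T) v k l mu v' k' l' mu' :
  strongly_regular e1 v k l mu -> strongly_regular e2 v k l mu ->
  strongly_regular e1 v' k' l' mu' -> strongly_regular e2 v' k' l' mu'.
Proof.
case=> [[sym1 irr1] v1 k1 l1 mu1] [e2_simple v2 k2 l2 mu2] [_ v1' k1' l1' mu1'].
have deg x y : #|[set z | e1 x z]| = #|[set z | e2 y z]|.
  by apply/eqP; rewrite -eqz_nat k1 k2.
split=> //; first by move=> x; rewrite -(k1' x) k1 k2.
  move=> x y exy; have: (0 < #|[set z | e1 x z]|)%N.
    by rewrite (deg x x); apply/card_gt0P; exists y; rewrite inE.
  case/card_gt0P => z; rewrite inE => exz.
  by rewrite l2 // -(l1 _ _ exz) l1'.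
move=> x y xy nexy; rewrite mu2 //.
(* The non-neighbour [y] of [x] in [e2] bounds the common degree, so [x] also has a non-neighbour in
   [e1], which forces [mu = mu']. *)
have: (#|[set z | e1 x z]| < #|[set~ x]|)%N.
  rewrite (deg x x); apply: proper_card; apply/properP; split.
    apply/subsetP => z; rewrite !inE; apply: contraTneq => ->.
    by rewrite e2_simple.2.
  by exists y; rewrite !inE // eq_sym.
rewrite ltnNge; case: (boolP [exists z, (x != z) && ~~ e1 x z]).
  by case/existsP=> z /andP[xz nexz] _; rewrite -(mu1 x z) // mu1'.
move/existsPn => nex /negP[]; apply: subset_leq_card; apply/subsetP => z.
rewrite !inE eq_sym => xz; have := nex z; rewrite xz /=; exact: negbNE.
Qed.

(** * Latin square type parameters and the fibres of a function *)

Section Fibres.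

Variables (R : realType) (p n : nat).
Hypotheses (p_prime : prime p) (p_gt2 : (2 < p)%N).
Local Notation C := (R[i]).
Local Notation V := 'rV['F_p]_n.

(** For these parameters the quadratic equation of the spectral form factors, at [x != 0], as (h -
    (N - r)) (h + r) = 0; at [x = 0] the coefficient is the degree. *)
Lemma strongly_regular_latin (D : {set V}) (N r : int) :
    (forall x, (- x \in D) = (x \in D)) -> 0 \notin D -> N ^+ 2 = (p ^ n)%:Z ->
  strongly_regular (cayley D)
    (N ^+ 2) ((N - 1) * r) (N + r ^+ 2 - 3 * r) (r ^+ 2 - r) <->
  fourier (indic R D) 0 = ((N - 1) * r)%:~R /\
  forall x, x != 0 -> fourier (indic R D) x = (N - r)%:~R \/
                      fourier (indic R D) x = (- r)%:~R.
Proof.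
move=> D_opp D_0 N2.
have pnE : (p ^ n)%:R = N%:~R ^+ 2 :> C by rewrite -rmorphXn /= N2 -pmulrn.
split=> [H | [h0 hx]].
  split.
    by case: H => _ _ kE _ _; rewrite -(kE 0) card_nbr // fourier_indic0 pmulrn.
  move=> x x0; have [_ /(_ x)] := (strongly_regular_fourier R p_prime p_gt2
    D_opp D_0 _ _ _ _).1 H.
  rewrite (negPf x0) mulr0; set h := fourier _ _ => hE.
  have /eqP : (h - (N - r)%:~R) * (h - (- r)%:~R) = 0.
    transitivity (h ^+ 2 - (((N - 1) * r)%:~R + (N + r ^+ 2 - 3 * r)%:~R * h
      + (r ^+ 2 - r)%:~R * (0 - 1 - h))); last by rewrite -hE subrr.
    ring.
  by rewrite mulf_eq0 !subr_eq0 => /orP[]/eqP; [left | right].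
apply/(strongly_regular_fourier R p_prime p_gt2 D_opp D_0); split=> // x.
have [->|x0] := eqVneq x 0; first by rewrite h0 pnE /=; ring.
by case: (hx x x0) => -> /=; ring.
Qed.

Definition fibre (f : V -> 'F_p) (a : 'F_p) : {set V} :=
  [set x | (f x == a) && (x != 0)].

Lemma fibre0 f a : 0 \notin fibre f a.
Proof. by rewrite inE eqxx andbF. Qed.

Lemma fibreN f a x : even_fun f -> (- x \in fibre f a) = (x \in fibre f a).
Proof. by move=> f_even; rewrite !inE f_even oppr_eq0. Qed.

Lemma natr_Fp_eq0 i : (1 <= i <= p)%N -> (i%:R == 0 :> 'F_p) = (i == p).
Proof.
case/andP=> i_gt0; rewrite leq_eqVlt => /predU1P[-> | i_ltp].
  by rewrite eqxx -val_eqE /= val_Fp_nat // modnn.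
by rewrite -val_eqE /= val_Fp_nat // modn_small // eqn0Ngt i_gt0 ltn_eqF.
Qed.

(* The residue of the index i identifies 1, ..., p with 'F_p. *)
Lemma level_set_fibre f i : f 0 = 0 -> (1 <= i <= p)%N ->
  level_set f i = fibre f i%:R.
Proof.
move=> f0 i_range; apply/setP => x; rewrite /level_set.
have := natr_Fp_eq0 i_range; have [-> i0|ip i0] := eqVneq i p.
  by rewrite !inE (eqP i0).
have i_ltp : (i < p)%N by rewrite ltn_neqAle ip; case/andP: i_range.
rewrite !inE -val_eqE /= val_Fp_nat // modn_small //.
case: eqVneq => //= fx; symmetry; apply: contraFneq i0 => x0.
by rewrite -val_eqE /= val_Fp_nat // modn_small // -fx x0 f0.
Qed.

(** Vectors are grouped by their value under [f], with 0 set apart. Taking [c = chi] yields the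
    Walsh transform, [c = 1] the sum of the eigenvalues. *)
Lemma sum_fibre f (c : 'F_p -> C) x :
  \sum_y c (f y) * chi R (- dot x y) =
  c (f 0) + \sum_a c a * fourier (indic R (fibre f a)) x.
Proof.
under [in RHS]eq_bigr do rewrite mulr_sumr.
rewrite exchange_big /= (bigD1 (0 : V)) //= [in RHS](bigD1 (0 : V)) //= dotC dot0l oppr0 chi0 mulr1.
rewrite [in RHS]big1 ?add0r; last first.
  by move=> a _; rewrite /indic (negPf (fibre0 _ _)) mul0r mulr0.
congr (_ + _); apply: eq_bigr => y y0; rewrite (bigD1 (f y)) //=.
rewrite /indic inE eqxx y0 mul1r big1 ?addr0 // => a /negPf fya.
by rewrite inE eq_sym fya mul0r mulr0.
Qed.

(** * Existence of the dual and the spectrum of its fibres *)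

Section LatinFibres.

Variables (f : V -> 'F_p) (N q : int).
Hypotheses (f_even : even_fun f) (f0 : f 0 = 0).
Hypotheses (N2 : N ^+ 2 = (p ^ n)%:Z) (Nq : N = q * p%:Z).

Definition fibre_r (a : 'F_p) : int := q + (a == 0)%:R.

Definition latin_fibres (g : V -> 'F_p) := forall a, let r := fibre_r a in
  strongly_regular (cayley (fibre g a))
    (N ^+ 2) ((N - 1) * r) (N + r ^+ 2 - 3 * r) (r ^+ 2 - r).

Lemma N_neq0 : N%:~R != 0 :> C.
Proof.
rewrite intr_eq0; apply/eqP => NE; move/eqP: N2; rewrite NE expr0n /= eqz_nat.
by rewrite eq_sym -[_ == _]negbK -lt0n expn_gt0 prime_gt0.
Qed.

Lemma sum_fibre_r (c : 'F_p -> C) :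
  \sum_a c a * (fibre_r a)%:~R = q%:~R * \sum_a c a + c 0.
Proof.
rewrite mulr_sumr (bigD1 0) //= [in RHS](bigD1 0) //= addrAC; congr (_ + _).
  by rewrite /fibre_r eqxx /=; ring.
by apply: eq_bigr => a /negPf a0; rewrite /fibre_r a0 addr0 mulrC.
Qed.

Lemma sum_fibre_r1 : \sum_a (fibre_r a)%:~R = N%:~R + 1 :> C.
Proof.
have := sum_fibre_r (fun=> 1); under eq_bigr do rewrite mul1r.
move=> ->; rewrite sumr_const cardT -cardE card_Fp // Nq rmorphM /=.
by rewrite -pmulrn.
Qed.

Hypothesis f_latin : latin_fibres f.

Lemma latin_fourier0 a :
  fourier (indic R (fibre f a)) 0 = ((N - 1) * fibre_r a)%:~R.
Proof.
by have [] := (strongly_regular_latin _ (fun x => fibreN a x f_even)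
  (fibre0 f a) N2).1 (f_latin a).
Qed.

(* The two possible eigenvalues differ by N, and the eigenvalues of the p
   fibres add up to -1: exactly one of them is the one not equal to - r. *)
Lemma latin_fourier x : x != 0 -> exists b, forall a,
  fourier (indic R (fibre f a)) x = N%:~R * (b == a)%:R - (fibre_r a)%:~R.
Proof.
move=> x0; pose eps a := fourier (indic R (fibre f a)) x == (N - fibre_r a)%:~R.
have epsE a :
    fourier (indic R (fibre f a)) x = N%:~R * (eps a)%:R - (fibre_r a)%:~R.
  have [_ /(_ x x0)] := (strongly_regular_latin _ (fun x => fibreN a x f_even)
    (fibre0 f a) N2).1 (f_latin a).
  rewrite /eps; case: eqP => [-> _|_ [//|->]]; first by rewrite mulr1 rmorphB.
  by rewrite mulr0 add0r rmorphN.
(* With s this sum, [sum_fibre] for [c = 1] reads 0 = 1 + N s - (N + 1) at [x != 0], and N is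
   nonzero. *)
have : \sum_a (eps a : nat) = 1%N.
  apply/eqP; rewrite -(eqr_nat C); apply/eqP/(mulfI N_neq0).
  have := sum_fibre f (fun=> 1) x.
  under eq_bigr do rewrite mul1r.
  under [in X in _ = X]eq_bigr do rewrite mul1r epsE.
  rewrite sum_chi_dot // (negPf x0) mulr0 sumrB sum_fibre_r1 -mulr_sumr -natr_sum.
  by set s := (\sum_a _)%:R => sE; rewrite mulr1 -[RHS]addr0 sE; ring.
case/eqP/sum_nat_eq1=> b [_ eb nb]; exists b => a; rewrite epsE.
have [<-|ba] := eqVneq b a; first by rewrite eb.
by rewrite (nb a _ _) // eq_sym.
Qed.

Lemma walshE x : walsh R f x = \sum_y chi R (f y) * chi R (- dot x y).
Proof. by apply: eq_bigr => y _; rewrite -chiD. Qed.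

Lemma is_dual_uniq g h : is_dual R N f g -> is_dual R N f h -> g =1 h.
Proof.
move=> gP hP x; apply: (chi_inj p_prime p_gt2 (R := R)).
by apply: (mulIf N_neq0); rewrite -[LHS]gP -[RHS]hP.
Qed.

(** Since [f] is even, substituting [- y] for [y] shows that the reflection of [g] is also a dual;
    uniqueness concludes. *)
Lemma is_dual_even g : is_dual R N f g -> even_fun g.
Proof.
move=> gP; apply: (is_dual_uniq (g := fun x => g (- x))) => // x.
rewrite -gP !walshE (reindex_inj oppr_inj) /=.
by apply: eq_bigr => y _; rewrite f_even dotNr dotNl opprK.
Qed.

(* Up to its value at 0, the Fourier transform of a fibre of f is an affine
   function of the indicator of the corresponding fibre of the dual. *)
Lemma latin_dual : exists2 fstar, is_dual R N f fstar & fstar 0 = 0 /\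
  forall a x, N%:~R * indic R (fibre fstar a) x =
    fourier (indic R (fibre f a)) x
    + (fibre_r a)%:~R * (1 - N%:~R * (x == 0)%:R).
Proof.
have /fin_all_exists[fstar fstarP] (x : V) : exists b : 'F_p,
    (x = 0 -> b = 0) /\ (x != 0 -> forall a,
    fourier (indic R (fibre f a)) x = N%:~R * (b == a)%:R - (fibre_r a)%:~R).
  have [->|x0] := eqVneq x 0; first by exists 0.
  have [b bP] := latin_fourier x0; exists b.
  by split=> // x_0; rewrite x_0 eqxx in x0.
have fstar0 : fstar 0 = 0 by apply: (fstarP 0).1.
exists fstar; last split=> // a x; last first.
  rewrite /indic inE; have [->|x0] := eqVneq x 0.
    by rewrite latin_fourier0 andbF /=; ring.
  by rewrite (fstarP x).2 // andbT /=; ring.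
move=> x; rewrite -/(chi R (fstar x)) walshE sum_fibre f0 chi0.
(* Since the values of [chi] sum to 0, the sum of [chi a * fibre_r a] is 1. So the transform is 1 +
   (N - 1) = N at 0, and elsewhere 1 + N chi (f* x) - 1. *)
have [->|x0] := eqVneq x 0.
  under eq_bigr do rewrite latin_fourier0 rmorphM /= mulrCA.
  rewrite -mulr_sumr sum_fibre_r sum_chi // fstar0 chi0 mulr0 add0r; ring.
under eq_bigr do rewrite (fstarP x).2 // mulrBr.
rewrite sumrB sum_fibre_r sum_chi // chi0 mulr0 add0r addrC subrK.
rewrite (bigD1 (fstar x)) //= eqxx mulr1 big1 ?addr0 // => a /negPf ax.
by rewrite eq_sym ax !mulr0.
Qed.

(** Transforming the relation and dividing by N, with p^n = N^2, gives the spectrum of the fibre of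
    [g]: N - r on the fibre of [f], - r at the other nonzero vectors, (N - 1) r at 0. *)
Lemma latin_dual_latin g : even_fun g ->
    (forall a x, N%:~R * indic R (fibre g a) x =
      fourier (indic R (fibre f a)) x
      + (fibre_r a)%:~R * (1 - N%:~R * (x == 0)%:R)) ->
  latin_fibres g.
Proof.
move=> g_even gP a /=.
have hatE y : fourier (indic R (fibre g a)) y = N%:~R * indic R (fibre f a) y
    + (fibre_r a)%:~R * (N%:~R * (y == 0)%:R - 1).
  have pnE : (p ^ n)%:R = N%:~R ^+ 2 :> C by rewrite -rmorphXn /= N2 -pmulrn.
  apply: (mulfI N_neq0); rewrite -fourierZ.
  transitivity (fourier (fourier (indic R (fibre f a))) y + (fibre_r a)%:~R *
      (fourier (fun=> 1) y - N%:~R * fourier (fun x => (x == 0)%:R) y)).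
    rewrite /fourier mulr_sumr -sumrB mulr_sumr -big_split /=.
    by apply: eq_bigr => x _; rewrite gP /fourier; ring.
  rewrite fourier_inv // fourier1 // fourier_delta0 /indic fibreN // pnE; ring.
apply/(strongly_regular_latin _ (fun x => fibreN a x g_even) (fibre0 g a) N2).
split=> [|y y0]; rewrite hatE /indic.
  by rewrite (negPf (fibre0 _ _)) eqxx /=; ring.
by rewrite (negPf y0); case: (_ \in _); [left | right] => /=; ring.
Qed.

End LatinFibres.

End Fibres.

(** * Passage between level sets indexed by 1, ..., p and fibres indexed by ['F_p] *)

Theorem theorem7p8 (R : realType) (p m : nat)
    (p_prime : prime p) (p_gt2 : (2 < p)%N) (m_gt0 : (0 < m)%N)
    (f : 'rV['F_p]_(2 * m) -> 'F_p) (f_even : even_fun f) (f0 : f 0 = 0)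
    (N : int) (N_type : N = (p ^ m)%N%:Z \/ N = - (p ^ m)%N%:Z)
    (f_feasible : all_feasible_type N f) :
  exists fstar : 'rV['F_p]_(2 * m) -> 'F_p,
    [/\ is_dual R N f fstar,
        forall g, is_dual R N f g -> g =1 fstar,
        even_fun fstar /\ fstar 0 = 0,
        forall i : nat, (1 <= i <= p)%N ->
          exists v k l mu : int,
            strongly_regular (component_graph fstar i) v k l mu &
        forall i : nat, (1 <= i <= p)%N -> forall v k l mu : int,
          strongly_regular (component_graph f i) v k l mu <->
          strongly_regular (component_graph fstar i) v k l mu].
Proof.
(* Both signs of N are treated at once, through N^2 = p^(2m) and the divisibility of N by p. *)
have N2 : N ^+ 2 = (p ^ (2 * m))%:Z.
  by rewrite mulnC expnM PoszM; case: N_type => ->; rewrite ?sqrrN expr2.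
have Nq : N = (N %/ p%:Z)%Z * p%:Z.
  rewrite divzK //.
  by case: N_type => ->; rewrite dvdzE ?abszN !absz_nat dvdn_exp.
have rE i : (1 <= i <= p)%N -> fibre_r (N %/ p%:Z)%Z (i%:R : 'F_p) = feasible_r p N i.
  move=> i_range; rewrite /fibre_r /feasible_r natr_Fp_eq0 //.
  by case: (i == p); rewrite ?addr0.
have graphE (g : 'rV['F_p]_(2 * m) -> 'F_p) i : g 0 = 0 -> (1 <= i <= p)%N ->
    component_graph g i = cayley (fibre g i%:R).
  by move=> g0 i_range; rewrite /component_graph level_set_fibre.
have f_latin : latin_fibres N (N %/ p%:Z)%Z f.
  (* The residue 0 is represented by the index [p], since indices start at 1. *)
  move=> a; pose i := if a == 0 then p else a : nat.
  have i_range : (1 <= i <= p)%N.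
    rewrite /i; case: eqVneq => [_|a0]; first by rewrite prime_gt0 /=.
    rewrite lt0n -[X in _ != X]/(val (0 : 'F_p)) val_eqE a0 /=.
    by rewrite -[X in (_ <= X)%N](Fp_cast p_prime) ltnW.
  have <- : i%:R = a.
    rewrite /i; case: eqVneq => [->|_]; last by rewrite natr_Zp.
    by apply/eqP; rewrite natr_Fp_eq0 ?eqxx // prime_gt0 /=.
  by rewrite /= rE // -graphE //; apply: f_feasible.
have [fstar fstar_dual [fstar0 fstarP]] :=
  latin_dual R p_prime p_gt2 f_even f0 N2 Nq f_latin.
have fstar_even := is_dual_even p_prime p_gt2 f_even N2 fstar_dual.
have fstar_latin := latin_dual_latin p_prime p_gt2 f_even N2 fstar_even fstarP.
exists fstar; split=> // [g g_dual | i i_range | i i_range v k l mu].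
- exact: (is_dual_uniq p_prime p_gt2 N2 g_dual fstar_dual).
- rewrite graphE //; do 4!eexists; exact: fstar_latin.
rewrite !graphE //; split; apply: strongly_regular_transfer;
  by [exact: f_latin | exact: fstar_latin].
Qed.
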